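(* Let $\widehat{\mathcal{R}}^\ast$ be the set of matrices $$R=\begin{pmatrix}a_1&0&0&d_1\\0&b_1&c_1&0\\0&c_2&b_2&0\\d_2&0&0&a_2\end{pmatrix}$$ such that $a_1a_2+b_1b_2\neq0$ and either ($d_1=d_2=0$ and $a_1a_2+b_1b_2-c_1c_2=0$) or ($c_1=c_2=0$ and $a_1a_2+b_1b_2-d_1d_2=0$). Define $\pi:\widehat{\mathcal{R}}^\ast\to\mathrm{GL}(4,\mathbb{C})$ by $$\pi(R)=\begin{pmatrix}c_1&0&0&0\\0&a_1&b_2&0\\0&-b_1&a_2&0\\0&0&0&c_2\end{pmatrix}\ \text{ if } c_1,c_2\neq0,\qquad \pi(R)=\begin{pmatrix}0&0&0&d_1\\0&ia_2&-ib_1&0\\0&ib_2&ia_1&0\\d_2&0&0&0\end{pmatrix}\ \text{ if } d_1,d_2\neq0,$$ where $i=\sqrt{-1}$. Then there is a composition law $(R,T)\mapsto R\circ T$ on $\widehat{\mathcal{R}}^\ast$ determined by the condition $\pi(R\circ T)=\pi(R)\pi(T)$ (that is, for all $R,T\in\widehat{\mathcal{R}}^\ast$ there is a unique $S\in\widehat{\mathcal{R}}^\ast$ with $\pi(S)=\pi(R)\pi(T)$), and $S=R\circ T$ satisfies $\llbracket R,S,T\rrbracket=0$.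
   Context: Let $V$ be a two-dimensional complex vector space with basis $v_+,v_-$, and identify $\operatorname{End}(V\otimes V)$ with $4\times4$ complex matrices using the ordered basis $v_+\otimes v_+,\ v_+\otimes v_-,\ v_-\otimes v_+,\ v_-\otimes v_-$. For $\phi\in\operatorname{End}(V\otimes V)$ define $\phi_{12},\phi_{13},\phi_{23}\in\operatorname{End}(V\otimes V\otimes V)$ by requiring, for $\phi=\phi'\otimes\phi''$, $\phi_{12}=\phi'\otimes\phi''\otimes1$, $\phi_{13}=\phi'\otimes1\otimes\phi''$, $\phi_{23}=1\otimes\phi'\otimes\phi''$, extended linearly; and $\llbracket\phi,\psi,\chi\rrbracket=\phi_{12}\psi_{13}\chi_{23}-\chi_{23}\psi_{13}\phi_{12}$. (Note that for $R\in\widehat{\mathcal{R}}^\ast$, the condition $a_1a_2+b_1b_2\neq0$ forces $c_1c_2\neq0$ in the first case and $d_1d_2\neq0$ in the second.) *)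

(* Defs.v *)
From HB Require Import structures.
From mathcomp Require Import all_boot all_order all_algebra.
From mathcomp Require Import reals.
From mathcomp Require Import complex mxtens.

Set Implicit Arguments.
Unset Strict Implicit.
Unset Printing Implicit Defensive.

Import GRing.Theory.
Local Open Scope ring_scope.

(* [V] has basis [v_+] (index 0), [v_-] (index 1), so that [End V] is ['M_2].
   [mxtens_index (i, k)] is [2 * i + k]: tensor powers of [V] carry the
   lexicographic basis, and [*t] is the Kronecker product. *)

(* The linear extension to [End (V ⊗ V)] of the map [A ⊗ B |-> f A B], for [f]
   bilinear, computed on the basis [E_ij ⊗ E_kl]. *)
Definition tens_ext (F : comNzRingType) (W : lmodType F)
    (f : 'M[F]_2 -> 'M[F]_2 -> W) (phi : 'M[F]_(2 * 2)) : W :=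
  \sum_(i < 2) \sum_(j < 2) \sum_(k < 2) \sum_(l < 2)
    phi (mxtens_index (i, k)) (mxtens_index (j, l)) *:
      f (delta_mx i j) (delta_mx k l).

Definition leg12 (F : comNzRingType) (phi : 'M[F]_(2 * 2)) : 'M[F]_(2 * 2 * 2) :=
  tens_ext (fun A B => A *t B *t 1%:M) phi.

Definition leg13 (F : comNzRingType) (phi : 'M[F]_(2 * 2)) : 'M[F]_(2 * 2 * 2) :=
  tens_ext (fun A B => A *t 1%:M *t B) phi.

Definition leg23 (F : comNzRingType) (phi : 'M[F]_(2 * 2)) : 'M[F]_(2 * 2 * 2) :=
  tens_ext (fun A B => 1%:M *t A *t B) phi.

Definition yang_baxter (F : comNzRingType) (phi psi chi : 'M[F]_(2 * 2)) :
    'M[F]_(2 * 2 * 2) :=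
  leg12 phi *m leg13 psi *m leg23 chi - leg23 chi *m leg13 psi *m leg12 phi.

Lemma tens_ext_linear (F : comNzRingType) (W : lmodType F)
    (f : 'M[F]_2 -> 'M[F]_2 -> W) : linear (tens_ext f).
Proof.
move=> a u v; rewrite /tens_ext.
do 4 (rewrite scaler_sumr -big_split; apply: eq_bigr => ? _ /=).
by rewrite !mxE scalerDl scalerA.
Qed.

Lemma tens_extE (F : comNzRingType) (W : lmodType F)
    (f : 'M[F]_2 -> 'M[F]_2 -> W) :
  (forall B, linear (f^~ B)) -> (forall A, linear (f A)) ->
  forall A B, tens_ext f (A *t B) = f A B.
Proof.
move=> fl fr A B.
have suml (g : 'M[F]_2 -> W) : linear g ->
    forall M, g M = \sum_(i < 2) \sum_(j < 2) M i j *: g (delta_mx i j).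
  move=> gl; pose h := GRing.isLinear.Build _ _ _ _ g gl.
  pose gL : {linear 'M[F]_2 -> W} := HB.pack g h.
  move=> M; rewrite -[g]/(gL : _ -> _) {1}[M]matrix_sum_delta linear_sum.
  apply: eq_bigr => i _; rewrite linear_sum; apply: eq_bigr => j _.
  by rewrite linearZ.
rewrite (suml _ (fl B)); apply: eq_bigr => i _; apply: eq_bigr => j _.
rewrite (suml _ (fr _)) scaler_sumr; apply: eq_bigr => k _.
rewrite scaler_sumr; apply: eq_bigr => l _.
by rewrite tensmxE scalerA.
Qed.

Lemma leg12E (F : comNzRingType) (A B : 'M[F]_2) :
  leg12 (A *t B) = A *t B *t 1%:M.
Proof.
by apply: (tens_extE (f := fun A B => A *t B *t 1%:M)) => ? a u v;
  apply/matrixP=> i j; rewrite !mxE ?mulrDr ?mulrDl ?mulrA // (mulrC _ a) ?mulrA.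
Qed.

Lemma leg13E (F : comNzRingType) (A B : 'M[F]_2) :
  leg13 (A *t B) = A *t 1%:M *t B.
Proof.
by apply: (tens_extE (f := fun A B => A *t 1%:M *t B)) => ? a u v;
  apply/matrixP=> i j; rewrite !mxE ?mulrDr ?mulrDl ?mulrA // (mulrC _ a) ?mulrA.
Qed.

Lemma leg23E (F : comNzRingType) (A B : 'M[F]_2) :
  leg23 (A *t B) = 1%:M *t A *t B.
Proof.
by apply: (tens_extE (f := fun A B => 1%:M *t A *t B)) => ? a u v;
  apply/matrixP=> i j; rewrite !mxE ?mulrDr ?mulrDl ?mulrA // (mulrC _ a) ?mulrA.
Qed.

Definition mx4 (F : nzRingType) (rows : seq (seq F)) : 'M[F]_4 :=
  \matrix_(i < 4, j < 4) (nth [::] rows i)`_j.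

Definition eight_vertex (F : nzRingType) (a1 a2 b1 b2 c1 c2 d1 d2 : F) :
    'M[F]_4 :=
  mx4 [:: [:: a1; 0;  0;  d1];
          [:: 0;  b1; c1; 0 ];
          [:: 0;  c2; b2; 0 ];
          [:: d2; 0;  0;  a2]].

Definition Rhat_star (F : fieldType) (M : 'M[F]_4) : Prop :=
  exists a1 a2 b1 b2 c1 c2 d1 d2 : F,
    [/\ M = eight_vertex a1 a2 b1 b2 c1 c2 d1 d2,
        a1 * a2 + b1 * b2 <> 0 &
        [/\ d1 = 0, d2 = 0 & a1 * a2 + b1 * b2 - c1 * c2 = 0] \/
        [/\ c1 = 0, c2 = 0 & a1 * a2 + b1 * b2 - d1 * d2 = 0]].

(* Total on ['M_4]; only its values on [Rhat_star] are meaningful, where the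
   second branch is exactly the case [d1, d2 != 0], see [Rhat_star_cases]. *)
Definition Rpi (K : realType) (M : 'M[K[i]]_4) : 'M[K[i]]_4 :=
  let a1 := M 0 0 in let a2 := M 3 3 in
  let b1 := M 1 1 in let b2 := M 2 2 in
  let c1 := M 1 2 in let c2 := M 2 1 in
  let d1 := M 0 3 in let d2 := M 3 0 in
  let I := 'i%C in
  if (c1 != 0) && (c2 != 0) then
    mx4 [:: [:: c1; 0;    0;  0 ];
            [:: 0;  a1;   b2; 0 ];
            [:: 0;  - b1; a2; 0 ];
            [:: 0;  0;    0;  c2]]
  else
    mx4 [:: [:: 0;  0;      0;          d1];
            [:: 0;  I * a2; - (I * b1); 0 ];
            [:: 0;  I * b2; I * a1;     0 ];
            [:: d2; 0;      0;          0 ]].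

Lemma Rhat_star_cases (F : fieldType) (M : 'M[F]_4) : Rhat_star M ->
  if (M 1 2 != 0) && (M 2 1 != 0) then M 0 3 = 0 /\ M 3 0 = 0
  else [/\ M 1 2 = 0, M 2 1 = 0 & (M 0 3 != 0) && (M 3 0 != 0)].
Proof.
move=> [a1 [a2 [b1 [b2 [c1 [c2 [d1 [d2 [-> ne]]]]]]]]]; rewrite !mxE /=.
case=> [[-> -> e]|[-> -> e]].
  suff: c1 * c2 != 0 by rewrite mulf_eq0 negb_or => ->.
  by move/subr0_eq: e => <-; apply/eqP.
rewrite eqxx /=; split=> //; rewrite -negb_or -mulf_eq0.
by move/subr0_eq: e => <-; apply/eqP.
Qed.

Lemma Rpi_c (K : realType) (a1 a2 b1 b2 c1 c2 d1 d2 : K[i]) :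
  c1 != 0 -> c2 != 0 ->
  Rpi (eight_vertex a1 a2 b1 b2 c1 c2 d1 d2) =
    mx4 [:: [:: c1; 0;    0;  0 ];
            [:: 0;  a1;   b2; 0 ];
            [:: 0;  - b1; a2; 0 ];
            [:: 0;  0;    0;  c2]].
Proof. by move=> c1n c2n; rewrite /Rpi !mxE /= c1n c2n. Qed.

Lemma Rpi_d (K : realType) (a1 a2 b1 b2 d1 d2 : K[i]) :
  Rpi (eight_vertex a1 a2 b1 b2 0 0 d1 d2) =
    mx4 [:: [:: 0;  0;         0;            d1];
            [:: 0;  'i%C * a2; - ('i%C * b1); 0 ];
            [:: 0;  'i%C * b2; 'i%C * a1;     0 ];
            [:: d2; 0;         0;             0 ]].
Proof. by rewrite /Rpi !mxE /= eqxx. Qed.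

(* Main.v *)
(** Writing [D = c1 c2] (or [D = d1 d2]) for the common value of
    [a1 a2 + b1 b2], the central 2x2 block and the corners of [Rpi R] both have
    determinant [D] (up to the same sign), so the image of [Rpi] is the set of
    invertible matrices of either shape whose two blocks have equal
    determinants. It is closed under products, and [Rpi] is injective, so
    [S] can be read off the product in each of the four cases; the
    Yang-Baxter equation is then a polynomial identity modulo the free-fermion
    relations. *)
Require Import Defs.
From mathcomp Require Import all_boot all_order all_algebra.
From mathcomp Require Import reals complex mxtens.
From mathcomp Require Import ring.
Import GRing.Theory.
Local Open Scope ring_scope.

Lemma sum_mxtens_index (V : nmodType) m n (G : 'I_(m * n) -> V) :
  \sum_k G k = \sum_(i < m) \sum_(j < n) G (mxtens_index (i, j)).
Proof.
rewrite pair_big /= (reindex (@mxtens_index m n)) /=.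
  by apply: eq_bigr => -[].
by exists (@mxtens_unindex m n) => k _;
  rewrite (mxtens_indexK, mxtens_unindexK).
Qed.

Definition ord2 (b : bool) : 'I_2 := if b then 1 else 0.

Lemma ord2_surj (P : 'I_2 -> Prop) : (forall b, P (ord2 b)) -> forall i, P i.
Proof.
move=> Pb [[|[|//]] lti].
  by rewrite (_ : Ordinal lti = ord2 false) //; apply: val_inj.
by rewrite (_ : Ordinal lti = ord2 true) //; apply: val_inj.
Qed.

Lemma sum_ord2 (V : nmodType) (G : 'I_2 -> V) :
  \sum_k G k = G (ord2 false) + G (ord2 true).
Proof.
by rewrite !big_ord_recl big_ord0 addr0; congr (G _ + G _); apply: val_inj.
Qed.

Section YangBaxter.
Variable F : comNzRingType.
Implicit Types (phi psi chi : 'M[F]_(2 * 2)) (i j k : 'I_2).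

Definition entry phi i k j l := phi (mxtens_index (i, k)) (mxtens_index (j, l)).

Notation idx3 i j k := (mxtens_index (mxtens_index (i, j), k)).

Lemma sum_mulr_eq (n : nat) (G : 'I_n -> F) (i : 'I_n) :
  \sum_k G k * (i == k)%:R = G i.
Proof.
rewrite (bigD1 i) //= eqxx mulr1 big1 ?addr0 // => k /negbTE.
by rewrite eq_sym => ->; rewrite mulr0.
Qed.

Lemma sum_delta4 phi i k j l :
  \sum_(i' < 2) \sum_(j' < 2) \sum_(k' < 2) \sum_(l' < 2)
    entry phi i' k' j' l' *
      ((i == i')%:R * (j == j')%:R * ((k == k')%:R * (l == l')%:R)) =
  entry phi i k j l.
Proof.
rewrite -(sum_mulr_eq _ (fun i' => entry phi i' k j l)); apply: eq_bigr => i' _.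
rewrite -(sum_mulr_eq _ (fun j' => entry phi i' k j' l)) mulr_suml.
apply: eq_bigr => j' _.
rewrite -(sum_mulr_eq _ (fun k' => entry phi i' k' j' l)) !mulr_suml.
apply: eq_bigr => k' _.
rewrite -(sum_mulr_eq _ (fun l' => entry phi i' k' j' l')) !mulr_suml.
by apply: eq_bigr => l' _; ring.
Qed.

Lemma leg12_entry phi i1 i2 i3 j1 j2 j3 :
  leg12 phi (idx3 i1 i2 i3) (idx3 j1 j2 j3) =
  entry phi i1 i2 j1 j2 * (i3 == j3)%:R.
Proof.
rewrite -sum_delta4 /leg12 /tens_ext summxE mulr_suml; apply: eq_bigr => i _.
do 3 (rewrite summxE mulr_suml; apply: eq_bigr => ? _).
by rewrite mxE !tensmxE !mxE -!mulnb !natrM /entry; ring.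
Qed.

Lemma leg13_entry phi i1 i2 i3 j1 j2 j3 :
  leg13 phi (idx3 i1 i2 i3) (idx3 j1 j2 j3) =
  entry phi i1 i3 j1 j3 * (i2 == j2)%:R.
Proof.
rewrite -sum_delta4 /leg13 /tens_ext summxE mulr_suml; apply: eq_bigr => i _.
do 3 (rewrite summxE mulr_suml; apply: eq_bigr => ? _).
by rewrite mxE !tensmxE !mxE -!mulnb !natrM /entry; ring.
Qed.

Lemma leg23_entry phi i1 i2 i3 j1 j2 j3 :
  leg23 phi (idx3 i1 i2 i3) (idx3 j1 j2 j3) =
  entry phi i2 i3 j2 j3 * (i1 == j1)%:R.
Proof.
rewrite -sum_delta4 /leg23 /tens_ext summxE mulr_suml; apply: eq_bigr => i _.
do 3 (rewrite summxE mulr_suml; apply: eq_bigr => ? _).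
by rewrite mxE !tensmxE !mxE -!mulnb !natrM /entry; ring.
Qed.

Lemma mulmx_leg12 phi (A : 'M[F]_(2 * 2 * 2)) i1 i2 i3 q :
  (leg12 phi *m A) (idx3 i1 i2 i3) q =
  \sum_(k1 < 2) \sum_(k2 < 2) entry phi i1 i2 k1 k2 * A (idx3 k1 k2 i3) q.
Proof.
rewrite mxE !sum_mxtens_index; apply: eq_bigr => k1 _; apply: eq_bigr => k2 _.
rewrite -(sum_mulr_eq _ (fun k3 => _ * A (idx3 k1 k2 k3) q)).
by apply: eq_bigr => k3 _; rewrite leg12_entry mulrAC.
Qed.

Lemma mulmx_leg13 phi (A : 'M[F]_(2 * 2 * 2)) i1 i2 i3 q :
  (leg13 phi *m A) (idx3 i1 i2 i3) q =
  \sum_(k1 < 2) \sum_(k3 < 2) entry phi i1 i3 k1 k3 * A (idx3 k1 i2 k3) q.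
Proof.
rewrite mxE !sum_mxtens_index; apply: eq_bigr => k1 _.
rewrite exchange_big; apply: eq_bigr => k3 _.
rewrite -(sum_mulr_eq _ (fun k2 => _ * A (idx3 k1 k2 k3) q)).
by apply: eq_bigr => k2 _; rewrite leg13_entry mulrAC.
Qed.

Lemma mulmx_leg23 phi (A : 'M[F]_(2 * 2 * 2)) i1 i2 i3 q :
  (leg23 phi *m A) (idx3 i1 i2 i3) q =
  \sum_(k2 < 2) \sum_(k3 < 2) entry phi i2 i3 k2 k3 * A (idx3 i1 k2 k3) q.
Proof.
rewrite mxE !sum_mxtens_index exchange_big; apply: eq_bigr => k2 _.
rewrite exchange_big; apply: eq_bigr => k3 _.
rewrite -(sum_mulr_eq _ (fun k1 => _ * A (idx3 k1 k2 k3) q)).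
by apply: eq_bigr => k1 _; rewrite leg23_entry mulrAC.
Qed.

Lemma leg13_leg23_entry psi chi i1 i2 i3 j1 j2 j3 :
  (leg13 psi *m leg23 chi) (idx3 i1 i2 i3) (idx3 j1 j2 j3) =
  \sum_(k < 2) entry psi i1 i3 j1 k * entry chi i2 k j2 j3.
Proof.
rewrite mulmx_leg13 exchange_big; apply: eq_bigr => k _.
rewrite -(sum_mulr_eq _ (fun k1 => entry psi i1 i3 k1 k * _)).
by apply: eq_bigr => k1 _; rewrite leg23_entry eq_sym mulrA.
Qed.

Lemma leg13_leg12_entry psi phi i1 i2 i3 j1 j2 j3 :
  (leg13 psi *m leg12 phi) (idx3 i1 i2 i3) (idx3 j1 j2 j3) =
  \sum_(k < 2) entry psi i1 i3 k j3 * entry phi k i2 j1 j2.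
Proof.
rewrite mulmx_leg13; apply: eq_bigr => k _.
rewrite -(sum_mulr_eq _ (fun k3 => entry psi i1 i3 k k3 * _)).
by apply: eq_bigr => k3 _; rewrite leg12_entry eq_sym mulrA.
Qed.

Lemma yang_baxter_eq0 phi psi chi :
  (forall i1 i2 i3 j1 j2 j3,
    \sum_(k1 < 2) \sum_(k2 < 2) entry phi i1 i2 k1 k2 *
      \sum_(k3 < 2) entry psi k1 i3 j1 k3 * entry chi k2 k3 j2 j3 =
    \sum_(k2 < 2) \sum_(k3 < 2) entry chi i2 i3 k2 k3 *
      \sum_(k1 < 2) entry psi i1 k3 k1 j3 * entry phi k1 k2 j1 j2) ->
  yang_baxter phi psi chi = 0.
Proof.
move=> eq_entry; apply/eqP; rewrite subr_eq0; apply/eqP.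
rewrite -!mulmxA; apply/matrixP => p q.
rewrite -[p]mxtens_unindexK -[q]mxtens_unindexK.
case: (mxtens_unindex p) (mxtens_unindex q) => [p' i3] [q' j3].
rewrite -[p']mxtens_unindexK -[q']mxtens_unindexK.
case: (mxtens_unindex p') (mxtens_unindex q') => [i1 i2] [j1 j2].
rewrite mulmx_leg12 mulmx_leg23.
under eq_bigr do under eq_bigr do rewrite leg13_leg23_entry.
under [RHS]eq_bigr do under eq_bigr do rewrite leg13_leg12_entry.
exact: eq_entry.
Qed.

Definition vertex_weight (a1 a2 b1 b2 c1 c2 d1 d2 : F) (i k j l : bool) : F :=
  match i, k, j, l with
  | false, false, false, false => a1
  | true, true, true, true => a2
  | false, true, false, true => b1
  | true, false, true, false => b2
  | false, true, true, false => c1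
  | true, false, false, true => c2
  | false, false, true, true => d1
  | true, true, false, false => d2
  | _, _, _, _ => 0
  end.

Lemma eight_vertex_entry a1 a2 b1 b2 c1 c2 d1 d2 (i k j l : bool) :
  entry (eight_vertex a1 a2 b1 b2 c1 c2 d1 d2)
    (ord2 i) (ord2 k) (ord2 j) (ord2 l) =
  vertex_weight a1 a2 b1 b2 c1 c2 d1 d2 i k j l.
Proof. by rewrite /entry mxE; case: i k j l => [] [] [] []. Qed.

Lemma yang_baxter_eight_vertex a1 a2 b1 b2 c1 c2 d1 d2
    a1' a2' b1' b2' c1' c2' d1' d2' a1'' a2'' b1'' b2'' c1'' c2'' d1'' d2'' :
  let u := vertex_weight a1 a2 b1 b2 c1 c2 d1 d2 in
  let v := vertex_weight a1' a2' b1' b2' c1' c2' d1' d2' in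
  let w := vertex_weight a1'' a2'' b1'' b2'' c1'' c2'' d1'' d2'' in
  let sum (G : bool -> F) := G false + G true in
  (forall i1 i2 i3 j1 j2 j3 : bool,
    sum (fun k1 : bool => sum (fun k2 : bool => u i1 i2 k1 k2 *
      sum (fun k3 : bool => v k1 i3 j1 k3 * w k2 k3 j2 j3))) =
    sum (fun k2 : bool => sum (fun k3 : bool => w i2 i3 k2 k3 *
      sum (fun k1 : bool => v i1 k3 k1 j3 * u k1 k2 j1 j2)))) ->
  yang_baxter (eight_vertex a1 a2 b1 b2 c1 c2 d1 d2)
    (eight_vertex a1' a2' b1' b2' c1' c2' d1' d2')
    (eight_vertex a1'' a2'' b1'' b2'' c1'' c2'' d1'' d2'') = 0.
Proof.
move=> u v w sum eq_weight; apply: yang_baxter_eq0.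
do 6 elim/ord2_surj=> ?.
by rewrite !sum_ord2 !eight_vertex_entry; apply: eq_weight.
Qed.

Section FreeFermion.
Variables (a1 a2 b1 b2 x1 x2 a1' a2' b1' b2' y1 y2 : F).
Hypotheses (relR : x1 * x2 = a1 * a2 + b1 * b2)
  (relT : y1 * y2 = a1' * a2' + b1' * b2').

Ltac solve_yang_baxter :=
  apply: yang_baxter_eight_vertex; do 6 case; rewrite /vertex_weight;
  rewrite ?(mul0r, mulr0, add0r, addr0); try done; ring: relR relT.

Lemma yang_baxter_cc :
  yang_baxter (eight_vertex a1 a2 b1 b2 x1 x2 0 0)
    (eight_vertex (a1 * a1' - b2 * b1') (a2 * a2' - b1 * b2')
       (b1 * a1' + a2 * b1') (a1 * b2' + b2 * a2') (x1 * y1) (x2 * y2) 0 0)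
    (eight_vertex a1' a2' b1' b2' y1 y2 0 0) = 0.
Proof. by solve_yang_baxter. Qed.

Lemma yang_baxter_cd :
  yang_baxter (eight_vertex a1 a2 b1 b2 x1 x2 0 0)
    (eight_vertex (a2 * a1' + b1 * b1') (a1 * a2' + b2 * b2')
       (a1 * b1' - b2 * a1') (a2 * b2' - b1 * a2') 0 0 (x1 * y1) (x2 * y2))
    (eight_vertex a1' a2' b1' b2' 0 0 y1 y2) = 0.
Proof. by solve_yang_baxter. Qed.

Lemma yang_baxter_dc :
  yang_baxter (eight_vertex a1 a2 b1 b2 0 0 x1 x2)
    (eight_vertex (a1 * a2' + b2 * b2') (a2 * a1' + b1 * b1')
       (b1 * a2' - a2 * b2') (b2 * a1' - a1 * b1') 0 0 (x1 * y2) (x2 * y1))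
    (eight_vertex a1' a2' b1' b2' y1 y2 0 0) = 0.
Proof. by solve_yang_baxter. Qed.

Lemma yang_baxter_dd :
  yang_baxter (eight_vertex a1 a2 b1 b2 0 0 x1 x2)
    (eight_vertex (b1 * b2' - a2 * a2') (b2 * b1' - a1 * a1')
       (b2 * a2' + a1 * b2') (a2 * b1' + b1 * a1') (x1 * y2) (x2 * y1) 0 0)
    (eight_vertex a1' a2' b1' b2' 0 0 y1 y2) = 0.
Proof. by solve_yang_baxter. Qed.

End FreeFermion.
End YangBaxter.

Lemma Rhat_starP (F : fieldType) (M : 'M[F]_4) : Rhat_star M ->
  exists a1 a2 b1 b2 x1 x2 : F,
    [/\ x1 != 0, x2 != 0, x1 * x2 = a1 * a2 + b1 * b2 &
        M = eight_vertex a1 a2 b1 b2 x1 x2 0 0 \/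
        M = eight_vertex a1 a2 b1 b2 0 0 x1 x2].
Proof.
move=> [a1 [a2 [b1 [b2 [c1 [c2 [d1 [d2 [-> ne]]]]]]]]].
case=> [[-> -> /subr0_eq e]|[-> -> /subr0_eq e]]; rewrite e in ne;
  move/eqP: ne; rewrite mulf_eq0 negb_or => /andP[x1n x2n].
  by exists a1, a2, b1, b2, c1, c2; split=> //; left.
by exists a1, a2, b1, b2, d1, d2; split=> //; right.
Qed.

Lemma Rhat_star_c (F : fieldType) (a1 a2 b1 b2 c1 c2 : F) :
  c1 != 0 -> c2 != 0 -> c1 * c2 = a1 * a2 + b1 * b2 ->
  Rhat_star (eight_vertex a1 a2 b1 b2 c1 c2 0 0).
Proof.
move=> c1n c2n e; exists a1, a2, b1, b2, c1, c2, 0, 0.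
split; rewrite -?e ?subrr; [by []|by apply/eqP; rewrite mulf_neq0|by left].
Qed.

Lemma Rhat_star_d (F : fieldType) (a1 a2 b1 b2 d1 d2 : F) :
  d1 != 0 -> d2 != 0 -> d1 * d2 = a1 * a2 + b1 * b2 ->
  Rhat_star (eight_vertex a1 a2 b1 b2 0 0 d1 d2).
Proof.
move=> d1n d2n e; exists a1, a2, b1, b2, 0, 0, d1, d2.
split; rewrite -?e ?subrr; [by []|by apply/eqP; rewrite mulf_neq0|by right].
Qed.

Definition mx_c {F : comNzRingType} (p q r s x y : F) : 'M[F]_4 :=
  mx4 [:: [:: x; 0; 0; 0]; [:: 0; p; q; 0]; [:: 0; r; s; 0]; [:: 0; 0; 0; y]].

Definition mx_d {F : comNzRingType} (p q r s x y : F) : 'M[F]_4 :=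
  mx4 [:: [:: 0; 0; 0; x]; [:: 0; p; q; 0]; [:: 0; r; s; 0]; [:: y; 0; 0; 0]].

Ltac mx4_compute :=
  apply/matrixP => -[[|[|[|[|//]]]] ?] [[|[|[|[|//]]]] ?];
  rewrite !mxE !big_ord_recl big_ord0 !mxE /=;
  rewrite !(mul0r, mulr0, add0r, addr0) //.

Section BlockProducts.
Variables (F : comNzRingType) (p q r s x y p' q' r' s' x' y' : F).

Lemma mul_mx_cc : mx_c p q r s x y *m mx_c p' q' r' s' x' y' =
  mx_c (p * p' + q * r') (p * q' + q * s') (r * p' + s * r') (r * q' + s * s')
    (x * x') (y * y').
Proof. by mx4_compute. Qed.

Lemma mul_mx_cd : mx_c p q r s x y *m mx_d p' q' r' s' x' y' =
  mx_d (p * p' + q * r') (p * q' + q * s') (r * p' + s * r') (r * q' + s * s')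
    (x * x') (y * y').
Proof. by mx4_compute. Qed.

Lemma mul_mx_dc : mx_d p q r s x y *m mx_c p' q' r' s' x' y' =
  mx_d (p * p' + q * r') (p * q' + q * s') (r * p' + s * r') (r * q' + s * s')
    (x * y') (y * x').
Proof. by mx4_compute. Qed.

Lemma mul_mx_dd : mx_d p q r s x y *m mx_d p' q' r' s' x' y' =
  mx_c (p * p' + q * r') (p * q' + q * s') (r * p' + s * r') (r * q' + s * s')
    (x * y') (y * x').
Proof. by mx4_compute. Qed.

Lemma mx_c_inj : mx_c p q r s x y = mx_c p' q' r' s' x' y' ->
  [/\ p = p', q = q', r = r' & [/\ s = s', x = x' & y = y']].
Proof.
move=> e; have ee i j := congr1 (fun A : 'M_4 => A i j) e.
by move: (ee 1 1) (ee 1 2) (ee 2 1) (ee 2 2) (ee 0 0) (ee 3 3); rewrite !mxE.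
Qed.

Lemma mx_d_inj : mx_d p q r s x y = mx_d p' q' r' s' x' y' ->
  [/\ p = p', q = q', r = r' & [/\ s = s', x = x' & y = y']].
Proof.
move=> e; have ee i j := congr1 (fun A : 'M_4 => A i j) e.
by move: (ee 1 1) (ee 1 2) (ee 2 1) (ee 2 2) (ee 0 3) (ee 3 0); rewrite !mxE.
Qed.

Lemma mx_c_neq_d : x != 0 -> mx_c p q r s x y <> mx_d p' q' r' s' x' y'.
Proof.
by move=> xn /(congr1 (fun A : 'M_4 => A 0 0)); rewrite !mxE /=; apply/eqP.
Qed.

End BlockProducts.

Lemma mx_c1 (F : comNzRingType) : mx_c 1 0 0 1 1 1 = 1%:M :> 'M[F]_4.
Proof.
by apply/matrixP => -[[|[|[|[|//]]]] ?] [[|[|[|[|//]]]] ?]; rewrite !mxE.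
Qed.

Section Composition.
Variable K : realType.
Implicit Types a b c d : K[i].

Lemma Rpi_cE a1 a2 b1 b2 c1 c2 : c1 != 0 -> c2 != 0 ->
  Rpi (eight_vertex a1 a2 b1 b2 c1 c2 0 0) = mx_c a1 b2 (- b1) a2 c1 c2.
Proof. exact: Rpi_c. Qed.

Lemma Rpi_dE a1 a2 b1 b2 d1 d2 :
  Rpi (eight_vertex a1 a2 b1 b2 0 0 d1 d2) =
  mx_d ('i%C * a2) (- ('i%C * b1)) ('i%C * b2) ('i%C * a1) d1 d2.
Proof. exact: Rpi_d. Qed.

Lemma mul_ii : 'i%C * 'i%C = -1 :> K[i].
Proof. by rewrite -expr2 sqr_i. Qed.

Lemma Rpi_inj (R S : 'M[K[i]]_4) :
  Rhat_star R -> Rhat_star S -> Rpi R = Rpi S -> R = S.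
Proof.
move=> /Rhat_starP [a1 [a2 [b1 [b2 [x1 [x2 [x1n x2n _ eR]]]]]]].
move=> /Rhat_starP [a1' [a2' [b1' [b2' [y1 [y2 [y1n y2n _ eS]]]]]]].
have iI : injective ( *%R ('i%C : K[i])).
  by apply: mulfI; apply: contra_eq_neq mul_ii => ->;
    rewrite mul0r eq_sym oppr_eq0 oner_eq0.
case: eR eS => -> [] ->; rewrite ?Rpi_dE ?Rpi_cE //.
- by case/mx_c_inj => -> -> /oppr_inj -> [-> -> ->].
- by move/mx_c_neq_d => /(_ x1n).
- by move/esym/mx_c_neq_d => /(_ y1n).
- by case/mx_d_inj => /iI -> /oppr_inj /iI -> /iI -> [/iI -> -> ->].
Qed.

Lemma Rpi_unitmx (R : 'M[K[i]]_4) : Rhat_star R -> Rpi R \in unitmx.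
Proof.
move=> /Rhat_starP [a1 [a2 [b1 [b2 [x1 [x2 [x1n x2n rel]]]]]]].
have i2 := mul_ii.
case=> ->; rewrite ?Rpi_dE ?Rpi_cE //.
  pose B := mx_c (a2 / (x1 * x2)) (- b2 / (x1 * x2)) (b1 / (x1 * x2))
    (a1 / (x1 * x2)) x1^-1 x2^-1.
  suff /mulmx1_unit[] : mx_c a1 b2 (- b1) a2 x1 x2 *m B = 1%:M by [].
  rewrite mul_mx_cc -mx_c1.
  by congr (mx_c _ _ _ _ _ _); field: rel; rewrite ?x1n ?x2n.
pose J := - 'i%C / (x1 * x2) : K[i].
pose B := mx_d (J * a1) (J * b1) (- J * b2) (J * a2) x2^-1 x1^-1.
suff /mulmx1_unit[] : mx_d ('i%C * a2) (- ('i%C * b1)) ('i%C * b2)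
  ('i%C * a1) x1 x2 *m B = 1%:M by [].
rewrite mul_mx_dd -mx_c1 /J; move: i2; generalize ('i%C : K[i]) => I i2.
by congr (mx_c _ _ _ _ _ _); field: rel i2; rewrite ?x1n ?x2n.
Qed.

Lemma Rhat_star_comp (R T : 'M[K[i]]_4) : Rhat_star R -> Rhat_star T ->
  exists S, [/\ Rhat_star S, Rpi S = Rpi R *m Rpi T & yang_baxter R S T = 0].
Proof.
move=> /Rhat_starP [a1 [a2 [b1 [b2 [x1 [x2 [x1n x2n relR eR]]]]]]].
move=> /Rhat_starP [a1' [a2' [b1' [b2' [y1 [y2 [y1n y2n relT eT]]]]]]].
have i2 := mul_ii; move: (Rpi_dE); move: i2.
generalize ('i%C : K[i]) => I i2 Rpi_dI.
case: eR eT => -> [] ->; rewrite ?Rpi_dI ?Rpi_cE //.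
- eexists; split; last exact: yang_baxter_cc.
    by apply: Rhat_star_c; rewrite ?mulf_neq0 //; ring: relR relT.
  by rewrite Rpi_cE ?mulf_neq0 // mul_mx_cc; congr (mx_c _ _ _ _ _ _); ring.
- eexists; split; last exact: yang_baxter_cd.
    by apply: Rhat_star_d; rewrite ?mulf_neq0 //; ring: relR relT.
  by rewrite Rpi_dI mul_mx_cd; congr (mx_d _ _ _ _ _ _); ring.
- eexists; split; last exact: yang_baxter_dc.
    by apply: Rhat_star_d; rewrite ?mulf_neq0 //; ring: relR relT.
  by rewrite Rpi_dI mul_mx_dc; congr (mx_d _ _ _ _ _ _); ring.
- eexists; split; last exact: yang_baxter_dd.
    by apply: Rhat_star_c; rewrite ?mulf_neq0 //; ring: relR relT.
  rewrite Rpi_cE ?mulf_neq0 // mul_mx_dd.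
  by congr (mx_c _ _ _ _ _ _); ring: i2.
Qed.

End Composition.

Theorem theorem8 (K : realType) :
  (forall R : 'M[K[i]]_4, Rhat_star R -> Rpi R \in unitmx) /\
  (forall R T : 'M[K[i]]_4, Rhat_star R -> Rhat_star T ->
    (exists! S : 'M[K[i]]_4, Rhat_star S /\ Rpi S = Rpi R *m Rpi T) /\
    (forall S : 'M[K[i]]_4, Rhat_star S -> Rpi S = Rpi R *m Rpi T ->
      yang_baxter R S T = 0)).
Proof.
split=> [R|R T hR hT]; first exact: Rpi_unitmx.
have [S [hS eS ybS]] := Rhat_star_comp _ _ _ hR hT.
have uniqS S' : Rhat_star S' -> Rpi S' = Rpi R *m Rpi T -> S = S'.
  by move=> hS' eS'; apply: Rpi_inj; rewrite // eS'.
split; last by move=> S' hS' /(uniqS _ hS') <-.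
by exists S; split=> // S' [hS' /(uniqS _ hS')].
Qed.
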